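(* For all pairs $(\alpha,\beta)$ with $\beta\ge 1\ge\alpha>0$ and all Borel sets $A\subset[0,1)$, \[ \|S_\beta(\mathbbm{1}_A)\|_\alpha\ \ge\ B_{\alpha,\beta}(|A|). \]
   Context: Work on $[0,1)$ with its Borel $\sigma$-algebra and Lebesgue measure $|\cdot|$. For $n\ge 0$ let $\mathcal{D}_n=\{[k/2^n,(k+1)/2^n): k=0,\dots,2^n-1\}$ and let $\mathcal{F}_n$ be the $\sigma$-algebra generated by $\mathcal{D}_n$. For $f\in L^1([0,1))$ put $f_n=\mathbb{E}(f\mid\mathcal{F}_n)$, $d_n=f_n-f_{n-1}$ for $n\ge1$, and for $\beta\ge1$ define $S_\beta(f)=\big(\sum_{n\ge1}|d_n|^\beta\big)^{1/\beta}\in[0,\infty]$. For $\alpha>0$, $\|g\|_\alpha=\big(\int_0^1|g|^\alpha\big)^{1/\alpha}$. For $\beta\ge 1\ge\alpha>0$, let $\mathcal{F}_{\alpha,\beta}$ be the family of all non-negative continuous functions $f$ on $[0,1]$ with $f(0)=f(1)=0$ satisfying \[ f\Big(\frac{x+y}{2}\Big)^{\alpha}\le \frac12\Big(f(x)^{\beta}+\Big|\frac{x-y}{2}\Big|^{\beta}\Big)^{\alpha/\beta}+\frac12\Big(f(y)^{\beta}+\Big|\frac{x-y}{2}\Big|^{\beta}\Big)^{\alpha/\beta}\qquad\text{for all }x,y\in[0,1]. \] $B_{\alpha,\beta}$ denotes the pointwise maximal element of $\mathcal{F}_{\alpha,\beta}$ (it exists), i.e. $B_{\alpha,\beta}(t)=\sup\{f(t):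 f\in\mathcal{F}_{\alpha,\beta}\}$ for $t\in[0,1]$. *)

(* Defs.v *)
From HB Require Import structures.
From mathcomp Require Import all_boot all_order all_algebra.
From mathcomp Require Import all_classical all_reals all_analysis.
Set Implicit Arguments.
Unset Strict Implicit.
Unset Printing Implicit Defensive.
Import Order.TTheory GRing.Theory Num.Theory.
Import numFieldNormedType.Exports.
Local Open Scope classical_set_scope.
Local Open Scope ring_scope.

(* The probability space [0, 1) is represented by functions on R that are only
   looked at on this interval. *)
Definition unit_ico (R : realType) : set R := `[0, 1[%classic.

Definition dyadic_ico (R : realType) (n k : nat) : set R :=
  `[k%:R / 2 ^+ n, k.+1%:R / 2 ^+ n[%classic.

Definition dyadics (R : realType) (n : nat) : set (set R) :=
  [set @dyadic_ico R n k | k in `I_(2 ^ n)].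

Definition dyadic_filtration (R : realType) (n : nat) : set (set R) :=
  <<s @unit_ico R, @dyadics R n >>.

(* g is a version, on [0, 1), of the conditional expectation of f given the
   sigma-algebra G of subsets of [0, 1) *)
Definition is_cond_exp (R : realType) (G : set (set R)) (f g : R -> R) : Prop :=
  [/\ (forall Y : set R, measurable Y -> G (@unit_ico R `&` g @^-1` Y)),
      (@lebesgue_measure R).-integrable (@unit_ico R) (EFin \o g) &
      forall B : set R, G B ->
        (\int[@lebesgue_measure R]_(x in B) (g x)%:E =
         \int[@lebesgue_measure R]_(x in B) (f x)%:E)%E].

Definition cond_exp (R : realType) (G : set (set R)) (f : R -> R) : R -> R :=
  xget (fun=> 0) [set g | is_cond_exp G f g].

(* Since every nonempty set of the n-th dyadic sigma-algebra has positive
   measure, the values of this function on [0, 1) do not depend on the version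
   selected by cond_exp. *)
Definition dyadic_mart (R : realType) (f : R -> R) (n : nat) : R -> R :=
  cond_exp (@dyadic_filtration R n) f.

(* used for n >= 1 only *)
Definition mart_diff (R : realType) (f : R -> R) (n : nat) (x : R) : R :=
  dyadic_mart f n x - dyadic_mart f n.-1 x.

Definition var_fun (R : realType) (beta : R) (f : R -> R) (x : R) : \bar R :=
  ((\sum_(1 <= n <oo) (`|mart_diff f n x| `^ beta)%:E) `^ beta^-1)%E.

Definition lebesgue_ico (R : realType) : {measure set (measurableTypeR R) -> \bar R} :=
  mrestr (@lebesgue_measure R) (measurable_itv `[(0 : R), 1[).

(* Elements are functions on R constrained on [0, 1] only. *)
Definition bellman_family (R : realType) (alpha beta : R) : set (R -> R) :=
  [set f : R -> R | [/\ {within `[0, 1], continuous f},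
               (forall x, x \in `[0, 1]%R -> 0 <= f x),
               f 0 = 0, f 1 = 0 &
               forall x y, x \in `[0, 1]%R -> y \in `[0, 1]%R ->
                 f ((x + y) / 2) `^ alpha <=
                 2^-1 * (f x `^ beta + `|(x - y) / 2| `^ beta)
                          `^ (alpha / beta) +
                 2^-1 * (f y `^ beta + `|(x - y) / 2| `^ beta)
                          `^ (alpha / beta)]].

(* The supremum is taken in the extended reals, so that no boundedness is
   presupposed (sup in R is 0 on unbounded sets). *)
Definition bellman_max (R : realType) (alpha beta t : R) : \bar R :=
  ereal_sup [set (f t)%:E | f in bellman_family alpha beta].

(* Main.v *)
Require Import Defs.
From HB Require Import structures.
From mathcomp Require Import all_boot all_order all_algebra.
From mathcomp Require Import all_classical all_reals all_analysis.
From mathcomp Require Import measurable_realfun ring lra.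
Set Implicit Arguments.
Unset Strict Implicit.
Unset Printing Implicit Defensive.
Import Order.TTheory GRing.Theory Num.Theory.
Import numFieldNormedType.Exports.
Local Open Scope classical_set_scope.
Local Open Scope ring_scope.

(* Let f be in the Bellman family, M_n = E(1_A | F_n) and
   T_n = sum_(i <= n) |d_i|^beta. Since w |-> (w^(beta/alpha) + s)^(alpha/beta)
   is convex and increasing, the family inequality still holds after s >= 0 is
   added inside each of its three powers, so E (f(M_n)^beta + T_n)^(alpha/beta)
   is nondecreasing in n. At n = 0 it equals f(|A|)^alpha, and by subadditivity
   of the power alpha/beta <= 1 it is at most
   E f(M_n)^alpha + E T_n^(alpha/beta), whose second term is bounded by
   E S_beta^alpha. The first term tends to 0: f(t)^alpha <= eps + C t (1 - t) on
   [0, 1], and E M_n (1 - M_n) is at most |U \ K| when K is compact, U is open,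
   K <= A <= U and every dyadic interval of length 2^-n that meets K lies in U.
   On [0, 1) everything is constant on dyadic intervals, so expectations are
   finite sums over the nodes (n, k) of the binary tree, k < 2^n, where the
   children of (n, k) are (n + 1, 2 k) and (n + 1, 2 k + 1). *)

(** * Inequalities for real powers *)

Lemma le_powR_add (R : realType) (a b r : R) : 0 <= a -> 0 <= b -> 0 < r <= 1 ->
  (a + b) `^ r <= a `^ r + b `^ r.
Proof.
move=> a0 b0 /andP[r0 r1].
have [ab0|ab0] := eqVneq (a + b) 0.
  by rewrite ab0 powR0 ?gt_eqF// addr_ge0// powR_ge0.
have abp : 0 < a + b by rewrite lt_def ab0 addr_ge0.
(* A ratio in [0, 1] does not decrease when raised to the power [r] in (0, 1], and the ratios of [a]
   and [b] to [a + b] add up to 1. *)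
have sc c : 0 <= c -> c <= a + b -> c / (a + b) * (a + b) `^ r <= c `^ r.
  move=> c0 cab; have [->|cn0] := eqVneq c 0; first by rewrite !mul0r powR_ge0.
  have abn := ltW abp.
  rewrite -[in leRHS](@divfK _ (a + b) _ c)// powRM ?divr_ge0//.
  rewrite ler_wpM2r ?powR_ge0// ger1_powR//.
  have cp : 0 < c by rewrite lt_def cn0.
  by rewrite divr_gt0//= ler_pdivrMr// mul1r.
have -> : (a + b) `^ r = a / (a + b) * (a + b) `^ r + b / (a + b) * (a + b) `^ r.
  by rewrite -mulrDl -mulrDl divff// mul1r.
by apply: lerD; apply: sc => //; rewrite ?lerDl ?lerDr.
Qed.

Lemma powR_le_conv (R : realType) (p t x y : R) : 1 <= p -> 0 <= t <= 1 ->
  0 <= x -> 0 <= y ->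
  (t * x + (1 - t) * y) `^ p <= t * x `^ p + (1 - t) * y `^ p.
Proof.
move=> p1 /andP[t0 t1] x0 y0.
have := @convex_powR R p p1 (Itv01 t0 t1) x y.
rewrite !inE /= !in_itv/= !andbT => /(_ x0 y0).
by rewrite !convRE /=.
Qed.

(** Reverse Minkowski inequality for the exponent [r <= 1], on two points of weight 1/2, for the
    pairs (u, v) and (s, s). In [tree_energy_le] the shift [s] is the variation accumulated up to
    the parent node. *)
Lemma powR_midpoint_shift (R : realType) (r u v w s : R) : 0 < r <= 1 ->
  0 <= u -> 0 <= v -> 0 <= w -> 0 <= s ->
  w `^ r <= 2^-1 * u `^ r + 2^-1 * v `^ r ->
  (w + s) `^ r <= 2^-1 * (u + s) `^ r + 2^-1 * (v + s) `^ r.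
Proof.
move=> /andP[r0 r1] u0 v0 w0 s0 wuv.
have [->|sn0] := eqVneq s 0; first by rewrite !addr0.
have sp : 0 < s by rewrite lt_def sn0.
set X := (u + s) `^ r; set Y := (v + s) `^ r.
have X0 : 0 < X by rewrite powR_gt0// ltr_wpDl.
have Y0 : 0 < Y by rewrite powR_gt0// ltr_wpDl.
pose L := 2^-1 * X + 2^-1 * Y.
have L0 : 0 < L by rewrite addr_gt0// mulr_gt0// invr_gt0.
have [Xge0 Yge0 Lge0] : [/\ 0 <= X, 0 <= Y & 0 <= L] by split; exact: ltW.
have h0 : 0 <= 2^-1 :> R by rewrite invr_ge0.
have p1 : 1 <= r^-1 by rewrite invf_ge1.
have rK z : 0 <= z -> (z `^ r) `^ r^-1 = z.
  by move=> z0; rewrite -powRrM divff ?gt_eqF// powRr1.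
pose t := 2^-1 * X / L.
have t01 : 0 <= t <= 1.
  by rewrite divr_ge0 ?mulr_ge0//= ler_pdivrMr// mul1r lerDl mulr_ge0.
have tE : 1 - t = 2^-1 * Y / L.
  rewrite /t -[X in X - _](divff (lt0r_neq0 L0)) -mulrBl.
  by rewrite {1}/L addrAC subrr add0r.
(* Jensen's inequality for the power [r^-1 >= 1], with weights [t] and [1 - t] proportional to [X]
   and [Y]. Dividing by [X] and [Y] before taking the power produces the denominators [u + s] and
   [v + s]. *)
have key a b : 0 <= a -> 0 <= b ->
    (2^-1 * a `^ r + 2^-1 * b `^ r) `^ r^-1 <=
    L `^ r^-1 * (t * (a / (u + s)) + (1 - t) * (b / (v + s))).
  move=> a0 b0.
  have -> : 2^-1 * a `^ r + 2^-1 * b `^ r =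
      L * (t * (a `^ r / X) + (1 - t) * (b `^ r / Y)).
    by rewrite tE /t; field; rewrite !gt_eqF.
  have ? : 0 <= 1 - t by case/andP: t01 => _; rewrite subr_ge0.
  have ? : 0 <= t by case/andP: t01.
  have ? : 0 <= a `^ r / X by rewrite divr_ge0 ?powR_ge0.
  have ? : 0 <= b `^ r / Y by rewrite divr_ge0 ?powR_ge0.
  rewrite powRM//; last by apply: addr_ge0; apply: mulr_ge0.
  rewrite ler_wpM2l ?powR_ge0//.
  apply: le_trans (powR_le_conv p1 t01 _ _) _ => //.
  rewrite -(rK (a / (u + s))) ?divr_ge0 ?addr_ge0//.
  rewrite -(rK (b / (v + s))) ?divr_ge0 ?addr_ge0//.
  have div z y : 0 <= z -> 0 < y -> (z / y) `^ r = z `^ r / y `^ r.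
    move=> z0 y0; rewrite powRM ?invr_ge0 ?(ltW y0)//.
    by rewrite -(powR_inv1 (ltW y0)) powRAC powR_inv1 ?powR_ge0.
  by rewrite !div// ltr_wpDl.
have kuv := key _ _ u0 v0.
have ks : s <= L `^ r^-1 * (t * (s / (u + s)) + (1 - t) * (s / (v + s))).
  rewrite -[leLHS](rK s s0) (_ : s `^ r = 2^-1 * s `^ r + 2^-1 * s `^ r).
    exact: key.
  by field.
have wle : w <= (2^-1 * u `^ r + 2^-1 * v `^ r) `^ r^-1.
  rewrite -[leLHS](rK w w0) ge0_ler_powR// ?invr_ge0 ?(ltW r0)// ?nnegrE ?powR_ge0//.
  by rewrite addr_ge0// mulr_ge0// ?powR_ge0 ?invr_ge0.
(* The bounds for (u, v) and (s, s) add up to exactly [L ^ r^-1]: u/(u + s) + s/(u + s) = 1,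
   likewise for [v], and the weights sum to 1. *)
have : w + s <= L `^ r^-1.
  apply: (le_trans (lerD (le_trans wle kuv) ks)).
  rewrite -mulrDr le_eqVlt; apply/orP; left; apply/eqP.
  by field; rewrite !gt_eqF// ltr_wpDl.
move=> /(@ge0_ler_powR _ r (ltW r0)).
rewrite -(powRrM L) mulVf ?gt_eqF// powRr1//; apply.
  by rewrite nnegrE addr_ge0.
by rewrite nnegrE powR_ge0.
Qed.

(** * Monotone energy on the binary tree *)

Lemma big_nat_double (R : nmodType) (F : nat -> R) m :
  \sum_(0 <= k < m.*2) F k = \sum_(0 <= k < m) (F k.*2 + F k.*2.+1).
Proof.
elim: m => [|m IH]; first by rewrite !big_geq.
by rewrite doubleS !big_nat_recr//= IH addrA.
Qed.

Section DyadicTree.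
Context {R : realType}.
Variables (alpha beta : R) (a : nat -> nat -> R).
Hypotheses (alpha_gt0 : 0 < alpha) (alpha_le1 : alpha <= 1) (beta_ge1 : 1 <= beta).
Hypothesis a01 : forall n k, a n k \in `[0, 1]%R.
Hypothesis a_split : forall n k, a n k = (a n.+1 k.*2 + a n.+1 k.*2.+1) / 2.

(** This is T_n at the node (n, k) when [a] is the martingale: the parent of (m + 1, k) is (m,
    [k./2]), so the recursion climbs the path to the root. *)
Fixpoint tree_var n k : R :=
  if n is m.+1 then tree_var m k./2 + `|a n k - a m k./2| `^ beta else 0.

Lemma tree_var_ge0 n k : 0 <= tree_var n k.
Proof. by elim: n k => //= n IH k; rewrite addr_ge0// powR_ge0. Qed.

Let beta_gt0 : 0 < beta. Proof. exact: lt_le_trans beta_ge1. Qed.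

Let r01 : 0 < alpha / beta <= 1.
Proof. by rewrite divr_gt0//= ler_pdivrMr// mul1r (le_trans alpha_le1). Qed.

Variables (f : R -> R) (f_family : bellman_family alpha beta f).

Let powf x : 0 <= f x -> (f x `^ beta) `^ (alpha / beta) = f x `^ alpha.
Proof. by move=> f0; rewrite -powRrM mulrC divfK ?gt_eqF. Qed.

Definition tree_energy n : R := (2 ^+ n)^-1 *
  \sum_(0 <= k < 2 ^ n) (f (a n k) `^ beta + tree_var n k) `^ (alpha / beta).

Lemma tree_energy_le n : tree_energy n <= tree_energy n.+1.
Proof.
case: f_family => _ f0 _ _ fmid.
rewrite /tree_energy expnS mul2n big_nat_double exprS invfM (mulrC 2^-1) -mulrA.
rewrite ler_wpM2l ?invr_ge0 ?exprn_ge0// mulr_sumr ler_sum// => k _ /=.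
rewrite doubleK uphalf_double.
set x := a n.+1 k.*2; set y := a n.+1 k.*2.+1.
have xI : x \in `[0, 1]%R by exact: a01.
have yI : y \in `[0, 1]%R by exact: a01.
have mid : a n k = (x + y) / 2 by exact: a_split.
(* The parent carries the mean of its children, so both increments have size |x - y| / 2, the
   quantity in the family inequality. *)
have -> : `|x - a n k| = `|(x - y) / 2| by rewrite mid; congr `|_|; field.
have -> : `|y - a n k| = `|(x - y) / 2|.
  by rewrite mid -[RHS]normrN; congr `|_|; field.
(* [powf] writes the left side as w^(alpha/beta) with w = f^beta, the form to which the shift by the
   parent's variation applies. *)
have := fmid x y xI yI; rewrite -mid -powf; last by apply: f0; exact: a01.
move=> /(powR_midpoint_shift r01 _ _ _ (tree_var_ge0 n k)).
rewrite !addr_ge0 ?powR_ge0// => /(_ isT isT isT)/le_trans; apply.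
by rewrite mulrDr !addrA -!(addrAC _ (tree_var n k)).
Qed.

Lemma bellman_root_le n : f (a 0 0) `^ alpha <=
  (2 ^+ n)^-1 * \sum_(0 <= k < 2 ^ n) f (a n k) `^ alpha +
  (2 ^+ n)^-1 * \sum_(0 <= k < 2 ^ n) tree_var n k `^ (alpha / beta).
Proof.
case: (f_family) => _ f0 _ _ _.
apply: (@le_trans _ _ (tree_energy n)).
  have -> : f (a 0 0) `^ alpha = tree_energy 0.
    rewrite /tree_energy expn0 big_nat1 expr0 invr1 mul1r /= addr0 powf//.
    by apply: f0; exact: a01.
  by elim: n => // n IH; exact: le_trans IH (tree_energy_le n).
rewrite -mulrDr ler_wpM2l ?invr_ge0 ?exprn_ge0// -big_split ler_sum// => k _ /=.
rewrite -(powf (f0 _ (a01 _ _))).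
by apply: le_powR_add; rewrite ?powR_ge0 ?tree_var_ge0.
Qed.

End DyadicTree.

(** * Boundary behaviour of the Bellman family *)

Lemma bellman_family_le_parabola (R : realType) (alpha beta : R) (f : R -> R) :
  0 < alpha -> bellman_family alpha beta f -> forall eps, 0 < eps ->
  exists2 C, 0 <= C &
    forall t, t \in `[0, 1]%R -> f t `^ alpha <= eps + C * (t * (1 - t)).
Proof.
move=> al0 [fc f0 f00 f10 _] eps eps0.
(* The threshold is chosen so that its power [alpha] is [eps]. *)
have e0 : 0 < eps `^ alpha^-1 by rewrite powR_gt0.
have fle t : t \in `[0, 1]%R -> f t < eps `^ alpha^-1 -> f t `^ alpha <= eps.
  move=> tI ft; rewrite -[leRHS](@powRr1 _ eps (ltW eps0)) -(mulVf (lt0r_neq0 al0)).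
  by rewrite powRrM ge0_ler_powR ?nnegrE ?powR_ge0 ?f0 ?(ltW ft)// ltW.
have [c cI fmax] := EVT_max ler01 fc.
have /(continuous_within_itvP _ ltr01)[_ c0 c1] := fc.
have [d1 d10 near0] : exists2 d, 0 < d &
    forall t, 0 < t -> t < d -> f t < eps `^ alpha^-1.
  have := cvgr_lt _ c0 (eps `^ alpha^-1); rewrite f00 => /(_ _ e0)[d /= d0 dP].
  exists d => // t t0 td; apply: dP => //=.
  by rewrite sub0r normrN gtr0_norm.
have [d2 d20 near1] : exists2 d, 0 < d &
    forall t, t < 1 -> 1 - d < t -> f t < eps `^ alpha^-1.
  have := cvgr_lt _ c1 (eps `^ alpha^-1); rewrite f10 => /(_ _ e0)[d /= d0 dP].
  exists d => // t t0 td; apply: dP => //=.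
  by rewrite gtr0_norm ?subr_gt0// ltrBlDr addrC -ltrBlDr.
pose M := f c `^ alpha.
have M0 : 0 <= M by exact: powR_ge0.
(* Between [d1] and [1 - d2] the product t (1 - t) is at least [d1 * d2], so this multiple of it is
   at least the maximum [M] of f^alpha. *)
exists (M / (d1 * d2)); first by rewrite divr_ge0// mulr_ge0// ltW.
move=> t tI; have := tI; rewrite in_itv/= => /andP[t0 t1].
have par : 0 <= M / (d1 * d2) * (t * (1 - t)).
  by rewrite mulr_ge0 ?divr_ge0 ?mulr_ge0 ?subr_ge0// ltW.
have small : f t < eps `^ alpha^-1 -> f t `^ alpha <= eps + M / (d1 * d2) * (t * (1 - t)).
  by move=> /(fle t tI)/le_trans; apply; rewrite lerDl.
(* The one-sided limits say nothing about the endpoints themselves, where the boundary values of [f]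
   are used. *)
have [tE|tn0] := eqVneq t 0; first by apply: small; rewrite tE f00.
have [tE|tn1] := eqVneq t 1; first by apply: small; rewrite tE f10.
have tp : 0 < t by rewrite lt_def tn0.
have tl1 : t < 1 by rewrite lt_def eq_sym tn1.
have [td1|d1t] := ltP t d1; first exact/small/near0.
have [td2|d2t] := ltP (1 - d2) t; first exact/small/near1.
apply: ler_wpDl; first exact: ltW.
apply: (@le_trans _ _ M).
  by rewrite ge0_ler_powR ?nnegrE ?f0 ?fmax// ltW.
rewrite mulrAC ler_pdivlMr ?mulr_gt0// ler_wpM2l//.
by apply: ler_pM => //; [exact: ltW|exact: ltW|rewrite lerBrDr addrC -lerBrDr].
Qed.

(** * Dyadic intervals and averages over them *)

Section DyadicIntervals.
Context {R : realType}.
Local Notation mu := (@lebesgue_measure R).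
Local Notation I n k := (@dyadic_ico R n k).

(** Clearing the denominator gives the condition that characterises [k] as the integer part of 2^n
    x, which makes [Num.truncn] the index of the interval containing [x]. *)
Lemma dyadic_icoE n k x :
  I n k x <-> k%:R <= 2 ^+ n * x < k.+1%:R.
Proof.
have p2 : 0 < 2 ^+ n :> R by rewrite exprn_gt0.
rewrite /dyadic_ico /= in_itv /= ler_pdivrMr// ltr_pdivlMr//.
by rewrite (mulrC x).
Qed.

Lemma dyadic_ico_truncn n k x : I n k x -> Num.truncn (2 ^+ n * x) = k.
Proof. by move=> /dyadic_icoE; exact: truncn_def. Qed.

Lemma dyadic_ico_inj n j k x : I n j x -> I n k x -> j = k.
Proof. by move=> /dyadic_ico_truncn <- /dyadic_ico_truncn. Qed.

Lemma trivIset_dyadic_ico n (D : set nat) : trivIset D (fun k => I n k).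
Proof. by move=> i j _ _ [x [Ii Ij]]; exact: dyadic_ico_inj Ii Ij. Qed.

Lemma truncn_dyadic_ico n x : unit_ico x ->
  (Num.truncn (2 ^+ n * x) < 2 ^ n)%N /\ I n (Num.truncn (2 ^+ n * x)) x.
Proof.
rewrite /unit_ico /= in_itv/= => /andP[x0 x1].
have y0 : 0 <= 2 ^+ n * x by rewrite mulr_ge0// exprn_ge0.
have /andP[le lt] := truncn_itv y0; split; last by apply/dyadic_icoE; rewrite le.
rewrite -(ltr_nat R) natrX (le_lt_trans le)//.
by rewrite -[ltRHS]mulr1 ltr_pM2l// exprn_gt0.
Qed.

Lemma dyadic_ico_sub_unit n k : (k < 2 ^ n)%N -> I n k `<=` @unit_ico R.
Proof.
move=> kn x /dyadic_icoE/andP[le lt].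
have p2 : 0 < 2 ^+ n :> R by rewrite exprn_gt0.
rewrite /unit_ico /= in_itv/=; apply/andP; split.
  by rewrite -(pmulr_rge0 _ p2) (le_trans _ le).
rewrite -(ltr_pM2l p2) mulr1 (lt_le_trans lt)//.
by rewrite -natrX ler_nat.
Qed.

Lemma measurable_dyadic_ico n k : measurable (I n k).
Proof. exact: measurable_itv. Qed.

Lemma lebesgue_dyadic_ico n k : mu (I n k) = ((2 ^+ n)^-1)%:E.
Proof.
have p2 : 0 < 2 ^+ n :> R by rewrite exprn_gt0.
rewrite /dyadic_ico lebesgue_measure_itv/= lte_fin ltr_pM2r ?invr_gt0//.
rewrite ltr_nat ltnSn -EFinB; congr EFin.
by rewrite -mulrBl -natr1 addrAC subrr add0r mul1r.
Qed.

Lemma dyadic_ico_split n k : I n k = I n.+1 k.*2 `|` I n.+1 k.*2.+1.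
Proof.
have e (j : nat) : (j.*2%:R = 2 * j%:R :> R) by rewrite -mul2n natrM.
apply/seteqP; split => x.
  move=> /dyadic_icoE; rewrite -(natr1 k) => /andP[le lt].
  have [h|h] := ltP (2 * (2 ^+ n * x)) (2 * k%:R + 1); [left|right];
    apply/dyadic_icoE; rewrite exprS -mulrA -?(natr1 k.*2.+1) -(natr1 k.*2) e; lra.
case=> /dyadic_icoE; rewrite exprS -mulrA -?(natr1 k.*2.+1) -(natr1 k.*2) e => h;
  apply/dyadic_icoE; rewrite -(natr1 k); lra.
Qed.

Lemma dyadic_ico_half n k : I n.+1 k `<=` I n k./2.
Proof.
rewrite [X in _ `<=` X]dyadic_ico_split => x.
by rewrite -[X in I _ X](odd_double_half k); case: (odd k) => Ix; [right|left].
Qed.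

Lemma unit_ico_dyadic n : @unit_ico R = \big[setU/set0]_(0 <= k < 2 ^ n) I n k.
Proof.
rewrite -bigcup_seq; apply/seteqP; split => [x /(truncn_dyadic_ico n)[kn xk]|x].
  by exists (Num.truncn (2 ^+ n * x)) => //=; rewrite mem_index_iota.
by case=> k /=; rewrite mem_index_iota => kn; exact: dyadic_ico_sub_unit.
Qed.

Lemma unit_ico0 : @unit_ico R = I 0 0.
Proof. by rewrite (unit_ico_dyadic 0) expn0 big_nat1. Qed.

Variables (A : set R) (mA : measurable A).

(** For k < 2^n this is the value of E(1_A | F_n) on the k-th interval. Larger [k] are kept so that
    the hypotheses on the tree values hold for all indices. *)
Definition dyadic_avg n k : R := 2 ^+ n * fine (mu (A `&` I n k)).

Lemma lebesgue_setI_dyadic_ico n k :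
  mu (A `&` I n k) = ((2 ^+ n)^-1 * dyadic_avg n k)%:E.
Proof.
have p2 : 2 ^+ n != 0 :> R by rewrite expf_neq0.
rewrite /dyadic_avg mulKf// fineK// ge0_fin_numE//.
rewrite (@le_lt_trans _ _ (mu (I n k)))//; last by rewrite lebesgue_dyadic_ico ltry.
rewrite le_measure ?inE//; first by apply: measurableI => //; exact: measurable_itv.
exact: measurable_itv.
Qed.

Lemma dyadic_avg_itv n k : dyadic_avg n k \in `[0, 1]%R.
Proof.
have p2 : 0 < 2 ^+ n :> R by rewrite exprn_gt0.
have : (mu (A `&` I n k) <= mu (I n k))%E.
  by rewrite le_measure ?inE//; [apply: measurableI => //|]; exact: measurable_itv.
rewrite lebesgue_setI_dyadic_ico lebesgue_dyadic_ico lee_fin -ler_pdivlMl ?invr_gt0//.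
rewrite invrK mulfV ?gt_eqF// in_itv/= => ->; rewrite andbT.
by rewrite mulr_ge0 ?exprn_ge0// fine_ge0.
Qed.

Lemma dyadic_avg_split n k :
  dyadic_avg n k = (dyadic_avg n.+1 k.*2 + dyadic_avg n.+1 k.*2.+1) / 2.
Proof.
have p2 : 2 ^+ n != 0 :> R by rewrite expf_neq0.
have : mu (A `&` I n k) =
    (mu (A `&` I n.+1 k.*2) + mu (A `&` I n.+1 k.*2.+1))%E.
  rewrite dyadic_ico_split setIUr measureU//.
  - by apply: measurableI => //; exact: measurable_itv.
  - by apply: measurableI => //; exact: measurable_itv.
  - rewrite -subset0 => x [[_ x1] [_ x2]].
    by have /eqP := dyadic_ico_inj x1 x2; rewrite ltn_eqF.
rewrite !lebesgue_setI_dyadic_ico -EFinD => -[] /(congr1 ( *%R (2 ^+ n))).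
by rewrite mulVKf// => ->; rewrite exprS; field.
Qed.

Lemma dyadic_avg0 : A `<=` @unit_ico R -> dyadic_avg 0 0 = fine (mu A).
Proof. by move=> AI; rewrite /dyadic_avg expr0 mul1r -unit_ico0 setIidl. Qed.

End DyadicIntervals.

(** * Conditional expectation on the dyadic sigma-algebras *)

Section DyadicMartingale.
Context {R : realType}.
Local Notation mu := (@lebesgue_measure R).
Local Notation I n k := (@dyadic_ico R n k).

(** The subsets of [0, 1) that split no interval of level [n] form a sigma-algebra containing the
    generators. *)
Lemma dyadic_filtration_atom n B : @dyadic_filtration R n B ->
  B `<=` @unit_ico R /\
  forall k x y, (k < 2 ^ n)%N -> I n k x -> I n k y -> B x -> B y.
Proof.
apply: (smallest_sub (C := sigma_algebra (@unit_ico R)) (X := fun B =>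
  B `<=` @unit_ico R /\
  forall k x y, (k < 2 ^ n)%N -> I n k x -> I n k y -> B x -> B y)).
  split=> [|{}B [BI Batom]|F HF].
  - by split => // x [].
  - split=> [x []//|k x y kn xk yk [_ nBx]]; split.
      exact: dyadic_ico_sub_unit kn _ yk.
    by move=> By; apply: nBx; exact: (Batom k y x kn yk xk By).
  - split=> [x [i _] /(HF i).1//|k x y kn xk yk [i _ Fx]].
    by exists i => //; exact: ((HF i).2 k x y kn xk yk Fx).
move=> _ [j jn <-]; split; first exact: dyadic_ico_sub_unit.
by move=> k x y kn xk yk xj; rewrite (dyadic_ico_inj xj xk).
Qed.

Lemma dyadic_filtration_bigsetU n (P : pred nat) :
  @dyadic_filtration R n (\big[setU/set0]_(0 <= k < 2 ^ n | P k) I n k).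
Proof.
rewrite -bigcup_seq_cond bigcup_mkcond.
apply: sigma_algebra_bigcup => k; case: ifPn => [|_]; last exact: sigma_algebra0.
rewrite inE /= mem_index_iota => /andP[kn _].
by apply: sub_sigma_algebra; exists k.
Qed.

Lemma dyadic_filtrationE n B : @dyadic_filtration R n B ->
  B = \big[setU/set0]_(0 <= k < 2 ^ n) (B `&` I n k).
Proof.
move=> /dyadic_filtration_atom[BI _].
by rewrite -big_distrr/= -unit_ico_dyadic setIidl.
Qed.

Lemma dyadic_filtration_measurable n B : @dyadic_filtration R n B -> measurable B.
Proof.
move=> GB; apply: (smallest_sub (C := sigma_algebra (@unit_ico R))
  (X := fun B => measurable (B : set R))) GB.
  split=> [|B' mB'|F mF].
  - exact: measurable0.
  - by apply: measurableD => //; exact: measurable_itv.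
  - exact: bigcup_measurable.
by move=> _ [k _ <-]; exact: measurable_itv.
Qed.

(** The level set of [g] through [x] lies in F_n and meets the interval, hence contains it. So any
    version is constant on the interval, and its value is fixed at every point rather than almost
    everywhere. *)
Lemma is_cond_exp_dyadicE n (f g : R -> R) k x :
  is_cond_exp (@dyadic_filtration R n) f g -> (k < 2 ^ n)%N -> I n k x ->
  ((g x)%:E * ((2 ^+ n)^-1)%:E = \int[mu]_(y in I n k) (f y)%:E)%E.
Proof.
move=> [mg _ intg] kn xk.
have GI : @dyadic_filtration R n (I n k) by apply: sub_sigma_algebra; exists k.
rewrite -intg// -(lebesgue_dyadic_ico n k) -integral_cst//; last exact: measurable_itv.
apply: eq_integral => y; rewrite inE => yk; congr EFin.
have [_ /(_ k x y kn xk yk)] := dyadic_filtration_atom (mg _ (measurable_set1 (g x))).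
by case; [split; [exact: dyadic_ico_sub_unit xk|]|].
Qed.

Variables (A : set R) (mA : measurable A).

(** Provides a version, so that [xget] in [cond_exp] returns a conditional expectation and not its
    default [fun=> 0]. *)
Lemma is_cond_exp_dyadic_avg n : is_cond_exp (@dyadic_filtration R n) \1_A
  (fun x => dyadic_avg A n (Num.truncn (2 ^+ n * x))).
Proof.
set g := fun x => _.
have gE k x : I n k x -> g x = dyadic_avg A n k by rewrite /g => /dyadic_ico_truncn ->.
have mg Y : @dyadic_filtration R n (@unit_ico R `&` g @^-1` Y).
  rewrite (_ : _ `&` _ =
    \big[setU/set0]_(0 <= k < 2 ^ n | dyadic_avg A n k \in Y) I n k).
    exact: dyadic_filtration_bigsetU.
  rewrite -bigcup_seq_cond; apply/seteqP; split => x.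
    move=> [/(truncn_dyadic_ico n)[kn xk] Yx].
    exists (Num.truncn (2 ^+ n * x)) => //=.
    by rewrite mem_index_iota kn; exact/mem_set.
  move=> [k /=]; rewrite mem_index_iota => /andP[kn /set_mem Yk] xk; split.
    exact: dyadic_ico_sub_unit kn _ xk.
  by rewrite /= (gE k).
have mgR : measurable_fun (@unit_ico R) g.
  by move=> _ Y _; exact: dyadic_filtration_measurable.
split => //.
- apply: measurable_bounded_integrable => //; first exact: measurable_itv.
    by rewrite unit_ico0 [ltLHS](lebesgue_dyadic_ico 0 0) ltry.
  exists 1; split => // M M1 x _ /=; rewrite (le_trans _ (ltW M1))//.
  have := dyadic_avg_itv mA n (Num.truncn (2 ^+ n * x)).
  by rewrite in_itv/= => /andP[g0 g1]; rewrite ger0_norm.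
- move=> B GB; have mB := dyadic_filtration_measurable GB.
  have mBI k : measurable (B `&` I n k).
    by apply: measurableI => //; exact: measurable_itv.
  have tBI : trivIset [set` index_iota 0 (2 ^ n)] (fun k => B `&` I n k).
    by apply: trivIset_setIl; exact: trivIset_dyadic_ico.
  have BI : B `<=` @unit_ico R by have [] := dyadic_filtration_atom GB.
  rewrite (dyadic_filtrationE GB) !integral_bigsetU_EFin ?iota_uniq//; last 2 first.
  - rewrite -(dyadic_filtrationE GB); apply/measurable_EFinP.
    exact: measurable_indic.
  - rewrite -(dyadic_filtrationE GB); apply/measurable_EFinP.
    by apply: measurable_funS mgR => //; exact: measurable_itv.
  apply: eq_big_nat => k /= kn; rewrite integral_indic//; last exact: mBI.
  (* A set of F_n either misses the interval or contains it. *)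
  have [->|/set0P[x [Bx xk]]] := eqVneq (B `&` I n k) set0.
    by rewrite setI0 measure0 integral_set0.
  have -> : B `&` I n k = I n k.
    apply: setIidr => y yk.
    by have [_ /(_ k x y kn xk yk Bx)] := dyadic_filtration_atom GB.
  rewrite (eq_integral (cst (dyadic_avg A n k)%:E)); last first.
    by move=> y /set_mem yk; rewrite /= (gE k).
  rewrite integral_cst ?[X in (_ * X)%E](lebesgue_dyadic_ico n k); last exact: measurable_itv.
  by rewrite [RHS]lebesgue_setI_dyadic_ico// -EFinM mulrC.
Qed.

Lemma dyadic_mart_indic n k x : (k < 2 ^ n)%N -> I n k x ->
  dyadic_mart \1_A n x = dyadic_avg A n k.
Proof.
move=> kn xk.
have H : is_cond_exp (@dyadic_filtration R n) \1_A (dyadic_mart \1_A n).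
  apply: (@xgetPex _ (fun=> 0)
    [set g | is_cond_exp (@dyadic_filtration R n) \1_A g]).
  by exists (fun x => dyadic_avg A n (Num.truncn (2 ^+ n * x)));
    exact: is_cond_exp_dyadic_avg.
have := is_cond_exp_dyadicE H kn xk.
rewrite integral_indic//; last exact: measurable_itv.
rewrite [RHS]lebesgue_setI_dyadic_ico// -EFinM mulrC => -[].
by apply: mulfI; rewrite invr_neq0// expf_neq0.
Qed.

End DyadicMartingale.

(** * Approximation of a measurable set by dyadic intervals *)

Section DyadicApproximation.
Context {R : realType}.
Local Notation mu := (@lebesgue_measure R).
Local Notation I n k := (@dyadic_ico R n k).

Lemma dyadic_avg_le (A B : set R) n k : measurable A -> measurable B ->
  A `&` I n k `<=` B -> dyadic_avg A n k <= dyadic_avg B n k.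
Proof.
move=> mA mB AB; have mI := @measurable_dyadic_ico R n k.
have : (mu (A `&` I n k) <= mu (B `&` I n k))%E.
  rewrite le_measure ?inE//; [exact: measurableI|exact: measurableI|].
  by move=> x AIx; split; [exact: AB|case: AIx].
by rewrite !lebesgue_setI_dyadic_ico// lee_fin ler_pM2l.
Qed.

Lemma dyadic_avgU_le (A B : set R) n k : measurable A -> measurable B ->
  dyadic_avg (A `|` B) n k <= dyadic_avg A n k + dyadic_avg B n k.
Proof.
move=> mA mB; have mI := @measurable_dyadic_ico R n k.
have mAB : measurable (A `|` B) by exact: measurableU.
have : (mu ((A `|` B) `&` I n k) <= mu (A `&` I n k) + mu (B `&` I n k))%E.
  by rewrite setIUl; apply: measureU2; exact: measurableI.
by rewrite !lebesgue_setI_dyadic_ico// -EFinD lee_fin -mulrDr ler_pM2l.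
Qed.

Lemma dyadic_avg_unit n k : dyadic_avg (I n k) n k = 1.
Proof.
have p2 : 2 ^+ n != 0 :> R by rewrite expf_neq0.
by rewrite /dyadic_avg setIid lebesgue_dyadic_ico /= mulfV.
Qed.

Lemma sum_dyadic_avg (A : set R) n : measurable A ->
  (2 ^+ n)^-1 * \sum_(0 <= k < 2 ^ n) dyadic_avg A n k = dyadic_avg A 0 0.
Proof.
move=> mA; elim: n => [|n <-]; first by rewrite expn0 big_nat1 expr0 invr1 mul1r.
rewrite expnS mul2n big_nat_double exprS invfM (mulrC 2^-1) -mulrA; congr (_ * _).
rewrite mulr_sumr; apply: eq_bigr => k _.
by rewrite (dyadic_avg_split mA n k) mulrC.
Qed.

(** If the ball of radius [e] about [x] lies in [U], an interval shorter than [e / 2] through a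
    point within [e / 2] of [x] stays in [U]. Compactness makes the level uniform over [K]. *)
Lemma compact_open_dyadic (K U : set R) : compact K -> open U -> K `<=` U ->
  \forall n \near \oo, forall x k, K x -> I n k x -> I n k `<=` U.
Proof.
move=> /compact_near_coveringP cK oU KU.
have := cK nat \oo (fun n x => forall k, I n k x -> I n k `<=` U) _.
suff near_in x : K x ->
    \forall x' \near x & n \near \oo, forall k, I n k x' -> I n k `<=` U.
  by move=> /(_ _ near_in); apply: filterS => n KP x k Kx; exact: KP.
move=> Kx; have /nbhs_ballP[e /= e0 xeU] : nbhs x U by exact: oU _ (KU _ Kx).
have e20 : 0 < e / 2 by rewrite divr_gt0.
near=> x' n => /= k /dyadic_icoE/andP[x'1 x'2] y /dyadic_icoE/andP[y1 y2].
apply: xeU; rewrite /ball /=.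
have xx' : `|x - x'| < e / 2 by near: x'; exact: nbhsx_ballx.
have en : 1 < 2 ^+ n * (e / 2).
  rewrite -ltr_pdivrMl ?exprn_gt0// mulr1 -div1r.
  by near: n; exact: (near_infty_natSinv_expn_lt (PosNum e20)).
have p2 : 0 < 2 ^+ n :> R by rewrite exprn_gt0.
have x'y : `|x' - y| < e / 2.
  rewrite -(ltr_pM2l p2) -{1}(gtr0_norm p2) -normrM mulrBr (lt_trans _ en)//.
  move: x'2 y2; rewrite -(natr1 k) ltr_norml => x'2 y2; apply/andP; split; lra.
by rewrite (splitr e) -(subrKA x') (le_lt_trans (ler_normD _ _))// ltrD.
Unshelve. all: by end_near. Qed.

Lemma dyadic_avg_parabola_small (A : set R) (eps : R) : measurable A ->
  A `<=` @unit_ico R -> 0 < eps -> exists n,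
  (2 ^+ n)^-1 * \sum_(0 <= k < 2 ^ n) dyadic_avg A n k * (1 - dyadic_avg A n k)
    <= eps.
Proof.
move=> mA AI eps0.
have e20 : 0 < eps / 2 by rewrite divr_gt0.
have muA : (mu A < +oo)%E.
  apply: (@le_lt_trans _ _ (mu (I 0 0))); last by rewrite lebesgue_dyadic_ico ltry.
  by rewrite -unit_ico0 le_measure ?inE//; exact: measurable_itv.
have [U [oU AU muU]] := lebesgue_regularity_outer mA muA e20.
have [K [cK KA muK]] := lebesgue_regularity_inner mA muA e20.
have mU : measurable U by exact: open_measurable.
have mK : measurable K by apply: closed_measurable; exact: compact_closed.
pose D := U `\` K.
have mD : measurable D by exact: measurableD.
have muD : (mu D < eps%:E)%E.
  apply: (@le_lt_trans _ _ (mu ((U `\` A) `|` (A `\` K)))).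
    rewrite le_measure ?inE//.
      by apply: measurableU; exact: measurableD.
    move=> x [Ux nKx]; have [Ax|nAx] := pselect (A x); [right|left]; by split.
  apply: (le_lt_trans (measureU2 _ _ _)); [exact: measurableD|exact: measurableD|].
  by rewrite (splitr eps) EFinD lteD.
have [n _ /(_ n (leqnn n)) KU] := compact_open_dyadic cK oU (subset_trans KA AU).
exists n; apply: (@le_trans _ _ (dyadic_avg D 0 0)); last first.
  rewrite -lee_fin /dyadic_avg expr0 mul1r fineK.
    apply: le_trans (ltW muD).
    rewrite le_measure ?inE//; apply: measurableI => //; exact: measurable_dyadic_ico.
  by rewrite lebesgue_setI_dyadic_ico.
rewrite -(sum_dyadic_avg n mD) ler_wpM2l ?invr_ge0 ?exprn_ge0// ler_sum// => k _.
have := dyadic_avg_itv mA n k; rewrite in_itv/= => /andP[a0 a1].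
have a1' : 0 <= 1 - dyadic_avg A n k by rewrite subr_ge0.
(* An interval meeting [K] lies in [U], hence in the union of [A] and [D], so 1 - M <=
   [dyadic_avg D] for the average M of [A]. An interval missing [K] meets [A] only inside [D], so M
   <= [dyadic_avg D]. Either way this bounds M (1 - M). *)
have [[x [Kx xk]]|nK] := pselect (K `&` I n k !=set0).
  have mI := @measurable_dyadic_ico R n k.
  have : 1 <= dyadic_avg A n k + dyadic_avg D n k.
    rewrite -(dyadic_avg_unit n k); apply: le_trans (dyadic_avgU_le n k mA mD).
    apply: dyadic_avg_le => //; first exact: measurableU.
    move=> y [yk _]; have Uy := KU x k Kx xk y yk.
    by have [Ky|nKy] := pselect (K y); [left; exact: KA|right].
  rewrite -lerBlDl; apply: le_trans.
  by rewrite -[leRHS]mul1r ler_wpM2r.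
apply: (@le_trans _ _ (dyadic_avg A n k)).
  by rewrite -[leRHS]mulr1 ler_wpM2l// gerBl.
apply: dyadic_avg_le => // x [Ax xk]; split; first exact: AU.
by move=> Kx; apply: nK; exists x.
Qed.

End DyadicApproximation.

(** * Lower bounds for integrals by dyadic step functions *)

Section SimpleFunctionBounds.
Import HBNNSimple.

(* Stated without measurability of [f] because [var_fun], which depends on
   [cond_exp], is an arbitrary function outside [0, 1). *)
Lemma le_integral_nnsfun d (T : measurableType d) (R : realType)
    (mu : {measure set T -> \bar R}) (h : {nnsfun T >-> R}) (f : T -> \bar R) :
  (forall x, ((h x)%:E <= f x)%E) ->
  (\int[mu]_x (h x)%:E <= \int[mu]_x f x)%E.
Proof.
move=> hf; rewrite integralT_nnsfun ge0_integralTE; last first.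
  by move=> x; rewrite (le_trans _ (hf x))// lee_fin.
by apply: ereal_sup_ubound; exists h.
Qed.

(** The left side is the integral of a step function. As [lebesgue_ico] is a measure on the whole
    line, the comparison is also made outside [0, 1), where the step function vanishes and [f] is
    nonnegative. *)
Lemma dyadic_sum_le_integral (R : realType) (n : nat) (c : nat -> R)
    (f : R -> \bar R) : (forall k, 0 <= c k) -> (forall x, (0 <= f x)%E) ->
  (forall k x, (k < 2 ^ n)%N -> @dyadic_ico R n k x -> ((c k)%:E <= f x)%E) ->
  (((2 ^+ n)^-1 * \sum_(0 <= k < 2 ^ n) c k)%:E <=
   \int[@lebesgue_ico R]_x f x)%E.
Proof.
move=> c0 f0 cf.
have mI k : measurable (@dyadic_ico R n k : set (measurableTypeR R)).
  exact: measurable_dyadic_ico.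
pose h : {nnsfun (measurableTypeR R) >-> R} := sum_nnsfun
  (fun k => scale_nnsfun (indic_nnsfun R (mI k)) (c0 k)) (2 ^ n).
have hE x : h x = \sum_(0 <= k < 2 ^ n) c k * \1_(@dyadic_ico R n k) x.
  by rewrite big_mkord sum_nnsfunE.
have -> : ((2 ^+ n)^-1 * \sum_(0 <= k < 2 ^ n) c k)%:E =
    (\int[@lebesgue_ico R]_x (h x)%:E)%E.
  under eq_integral do rewrite hE -sumEFin.
  rewrite ge0_integral_sum//=; last 2 first.
  - by move=> k; apply/measurable_EFinP; apply: measurable_funM.
  - by move=> k x _; rewrite lee_fin mulr_ge0.
  rewrite mulr_sumr -sumEFin; apply: eq_big_nat => k /= kn.
  under eq_integral do rewrite EFinM.
  rewrite ge0_integralZl_EFin//; last first.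
  - by apply/measurable_EFinP; exact: measurable_indic.
  rewrite integral_indic// setIT mulrC EFinM; congr (_ * _)%E.
  rewrite -(lebesgue_dyadic_ico n k) /lebesgue_ico /= /mrestr setIidl//.
  exact: dyadic_ico_sub_unit.
apply: le_integral_nnsfun => x; rewrite hE.
have [xI|nxI] := pselect (unit_ico x).
  have [kn xk] := truncn_dyadic_ico n xI.
  set k := Num.truncn _ in kn xk.
  rewrite (bigD1_seq k) ?mem_index_iota ?iota_uniq//= big1.
    by rewrite addr0 indicE mem_set// mulr1 cf.
  move=> j jk; rewrite indicE memNset ?mulr0// => xj.
  by move/eqP : jk; apply; exact: dyadic_ico_inj xj xk.
rewrite big_nat big1// => k /= kn; rewrite indicE memNset ?mulr0// => xk.
by apply: nxI; exact: dyadic_ico_sub_unit kn _ xk.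
Qed.

End SimpleFunctionBounds.

(** * From the tree to the variation of the indicator *)

Lemma tree_var_le_var_fun (R : realType) (beta : R) (A : set R) n k x :
  0 < beta -> measurable A -> (k < 2 ^ n)%N -> @dyadic_ico R n k x ->
  ((tree_var beta (dyadic_avg A) n k `^ beta^-1)%:E <= var_fun beta \1_A x)%E.
Proof.
move=> beta0 mA kn xk.
rewrite /var_fun -poweR_EFin.
have d0 i : (0 <= (`|mart_diff \1_A i x| `^ beta)%:E)%E by rewrite lee_fin powR_ge0.
apply: gt0_ler_poweR; rewrite ?invr_ge0 ?(ltW beta0)//.
- by rewrite in_itv/= lee_fin tree_var_ge0 leey.
- by rewrite in_itv/= leey andbT; apply: nneseries_ge0.
(* The upper bound [n.+1] is exclusive, so this partial sum ends with the increment of index [n] and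
   equals [tree_var]. *)
apply: le_trans (nneseries_lim_ge n.+1 _) => //.
rewrite sumEFin lee_fin le_eqVlt; apply/orP; left; apply/eqP.
elim: n k kn xk => [|n IH] k kn xk; first by rewrite big_geq.
have kn2 : (k./2 < 2 ^ n)%N.
  by rewrite ltn_half_double -mul2n -expnS.
have xk2 := dyadic_ico_half xk.
rewrite big_nat_recr//= -(IH k./2)//; congr (_ + _ `^ _).
by rewrite /mart_diff (dyadic_mart_indic mA kn)// (dyadic_mart_indic mA kn2).
Qed.

Theorem theorem1p4 (R : realType) (alpha beta : R)
    (alpha_gt0 : 0 < alpha) (alpha_le1 : alpha <= 1) (beta_ge1 : 1 <= beta)
    (A : set R) (mA : measurable A) (A_sub : A `<=` @unit_ico R) :
  (bellman_max alpha beta (fine (@lebesgue_measure R A)) <=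
   Lnorm (@lebesgue_ico R) alpha%:E (var_fun beta \1_A))%E.
Proof.
have beta_gt0 : 0 < beta by exact: lt_le_trans beta_ge1.
apply: ge_ereal_sup => _ [f ff <-]; rewrite -(dyadic_avg0 A_sub).
have [_ f0 _ _ _] := ff.
have t01 := dyadic_avg_itv mA 0 0.
set t := dyadic_avg A 0 0 in t01 *.
rewrite unlock; set J := (\int[_]_x _)%E.
(* Both sides are raised to the power [alpha], which removes the outer root of the norm. *)
suff ftJ : ((f t `^ alpha)%:E <= J)%E.
  have -> : (f t)%:E = ((f t `^ alpha)%:E `^ alpha^-1)%E.
    by rewrite poweR_EFin -powRrM mulfV ?gt_eqF// powRr1// f0.
  apply: gt0_ler_poweR; rewrite ?invr_ge0 ?(ltW alpha_gt0)//.
    by rewrite in_itv/= lee_fin powR_ge0 leey.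
  by rewrite in_itv/= leey andbT; apply: integral_ge0 => x _; exact: poweR_ge0.
(* An arbitrary error [e] replaces the passage to the limit: a single level [n] is enough for each
   [e]. *)
apply/lee_addgt0Pr => e e0.
have e20 : 0 < e / 2 by rewrite divr_gt0.
have [C C0 fC] := bellman_family_le_parabola alpha_gt0 ff e20.
have C10 : 0 < C + 1 by rewrite ltr_wpDl.
(* Half of [e] pays for the constant term of the parabola bound and half for its multiple of t (1 -
   t). Dividing by [C + 1] covers [C = 0]. *)
have [|n small] := dyadic_avg_parabola_small mA A_sub (eps := e / 2 / (C + 1)).
  by rewrite divr_gt0.
have root := bellman_root_le alpha_gt0 alpha_le1 beta_ge1
  (dyadic_avg_itv mA) (dyadic_avg_split mA) ff n.
have body : (2 ^+ n)^-1 * \sum_(0 <= k < 2 ^ n) f (dyadic_avg A n k) `^ alpha <= e.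
  apply: (@le_trans _ _ ((2 ^+ n)^-1 * \sum_(0 <= k < 2 ^ n)
      (e / 2 + C * (dyadic_avg A n k * (1 - dyadic_avg A n k))))).
    rewrite ler_wpM2l ?invr_ge0 ?exprn_ge0// ler_sum// => k _.
    by apply: fC; exact: dyadic_avg_itv.
  rewrite big_split/= sumr_const_nat subn0 -mulr_sumr mulrDr mulrCA.
  rewrite -[e / 2 *+ _]mulr_natl natrX mulKf ?expf_neq0//.
  rewrite [leRHS]splitr lerD2l; apply: le_trans (ler_wpM2l C0 small) _.
  by rewrite mulrCA -[leRHS]mulr1 ler_wpM2l ?(ltW e20)// ler_pdivrMr// mul1r lerDl.
apply: le_trans (_ : _ <= (e + (2 ^+ n)^-1 * \sum_(0 <= k < 2 ^ n)
    tree_var beta (dyadic_avg A) n k `^ (alpha / beta))%:E)%E _.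
  by rewrite lee_fin; apply: le_trans root _; rewrite lerD2r.
rewrite EFinD addeC leeD2r//; apply: dyadic_sum_le_integral.
- by move=> k; exact: powR_ge0.
- by move=> x; exact: poweR_ge0.
move=> k x kn xk; have tv := tree_var_le_var_fun beta_gt0 mA kn xk.
(* Splitting T^(alpha/beta) as (T^(1/beta))^alpha reduces the claim to the pointwise bound by
   [var_fun]. *)
rewrite mulrC powRrM -poweR_EFin.
have v0 : (0 <= var_fun beta \1_A x)%E by exact: poweR_ge0.
rewrite gee0_abs//; apply: gt0_ler_poweR; rewrite ?(ltW alpha_gt0)//.
  by rewrite in_itv/= lee_fin powR_ge0 leey.
by rewrite in_itv/= v0 leey.
Qed.
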